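(* The following mixed-integer formulation in the variables $(x,y,z,\lambda,\Delta y,s)\in\mathbb{R}\times\mathbb{R}\times\mathbb{R}\times\mathbb{R}^2\times\mathbb{R}^2\times\mathbb{R}^2$ (the logarithmic formulation of Misener et al. for a piecewise McCormick relaxation of the bilinear term $z=xy$ on $[0,3]^2$, with $N_P=3$ uniform pieces in $x$) is not ideal: $$\lambda_1+2\lambda_2\le x,\qquad x\le 1+\lambda_1+2\lambda_2,\qquad 1+\lambda_1+2\lambda_2\le 3,$$ $$\Delta y_1\le 3\lambda_1,\qquad \Delta y_2\le 3\lambda_2,\qquad \Delta y_1=y-s_1,\qquad \Delta y_2=y-s_2,$$ $$s_1\le 3(1-\lambda_1),\qquad s_2\le 3(1-\lambda_2),$$ $$z\ge\Delta y_1+2\Delta y_2,\qquad z\ge 3x+(y-3)+(\Delta y_1-3\lambda_1)+2(\Delta y_2-3\lambda_2),$$ $$z\le y+\Delta y_1+2\Delta y_2,\qquad z\le 3x+(\Delta y_1-3\lambda_1)+2(\Delta y_2-3\lambda_2),$$ $$\lambda\in\{0,1\}^2,\quad \Delta y\in[0,3]^2,\quad s\in[0,3]^2,\quad (x,y)\in[0,3]\times[0,3].$$ Indeed, the point $x=3$, $y=3$, $z=9$, $\lambda=(1,0.5)$, $\Delta y=(3,1.5)$, $s=(0,1.5)$ is an extreme point of its linear programming relaxation.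
   Context: The linear programming relaxation is obtained by replacing $\lambda\in\{0,1\}^2$ with $\lambda\in[0,1]^2$. A formulation is ideal if at every extreme point of its linear programming relaxation all the binary variables (here $\lambda_1,\lambda_2$) take values in $\{0,1\}$. *)

(* Defs.v *)
From HB Require Import structures.
From mathcomp Require Import all_boot all_order all_algebra.
From mathcomp Require Import classical_sets reals.

Set Implicit Arguments.
Unset Strict Implicit.
Unset Printing Implicit Defensive.

Import Order.TTheory GRing.Theory Num.Theory.
Local Open Scope classical_set_scope.
Local Open Scope ring_scope.

Definition extreme_point (R : realType) (V : lmodType R) (P : set V) (p : V) :
    Prop :=
  P p /\ forall (a b : V) (t : R), P a -> P b -> 0 < t < 1 ->
    p = t *: a + (1 - t) *: b -> a = p /\ b = p.

(* The integrality requirement is kept apart from the other constraints, so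
   that it can be relaxed. *)
Record formulation (R : realType) (V : lmodType R) := Formulation {
  base_constraints : set V;
  nbin : nat;
  binvar : 'I_nbin -> V -> R }.
Arguments binvar {R V} f i v.

Definition solutions_with (R : realType) (V : lmodType R)
    (F : formulation V) (D : set R) : set V :=
  [set v | base_constraints F v /\ forall i, D (binvar F i v)].

Definition mip_feasible (R : realType) (V : lmodType R) (F : formulation V) :
  set V := solutions_with F [set 0; 1].

Definition lp_relaxation (R : realType) (V : lmodType R) (F : formulation V) :
  set V := solutions_with F [set t | 0 <= t <= 1].

Definition ideal (R : realType) (V : lmodType R) (F : formulation V) : Prop :=
  forall p : V, extreme_point (lp_relaxation F) p ->
    forall i, [set 0; 1] (binvar F i p).

(* (x, y, z, lambda, Delta y, s); R^o is R viewed as a vector space over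
   itself. *)
Definition mccormick_space (R : realType) : lmodType R :=
  (R^o * R^o * R^o * 'rV[R]_2 * 'rV[R]_2 * 'rV[R]_2)%type.

Definition mccormick_point (R : realType) (x y z : R) (lam dy s : 'rV[R]_2) :
  mccormick_space R := (x, y, z, lam, dy, s).

(* Indices are shifted: v 0 0 is v_1 and v 0 1 is v_2. *)
Definition log_constraints (R : realType) (x y z : R) (lam dy s : 'rV[R]_2) :
    Prop :=
  let lam1 := lam 0 0 in let lam2 := lam 0 1 in
  let dy1 := dy 0 0 in let dy2 := dy 0 1 in
  let s1 := s 0 0 in let s2 := s 0 1 in
  [/\ [/\ lam1 + 2 * lam2 <= x,
          x <= 1 + lam1 + 2 * lam2 &
          1 + lam1 + 2 * lam2 <= 3],
      [/\ dy1 <= 3 * lam1, dy2 <= 3 * lam2, dy1 = y - s1 & dy2 = y - s2],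
      s1 <= 3 * (1 - lam1) /\ s2 <= 3 * (1 - lam2),
      [/\ z >= dy1 + 2 * dy2,
          z >= 3 * x + (y - 3) + (dy1 - 3 * lam1) + 2 * (dy2 - 3 * lam2),
          z <= y + dy1 + 2 * dy2 &
          z <= 3 * x + (dy1 - 3 * lam1) + 2 * (dy2 - 3 * lam2)] &
      [/\ forall i, 0 <= dy 0 i <= 3,
          forall i, 0 <= s 0 i <= 3,
          0 <= x <= 3 &
          0 <= y <= 3]].

Definition log_formulation (R : realType) : formulation (mccormick_space R) :=
  @Formulation R (mccormick_space R)
    [set v | let: (x, y, z, lam, dy, s) := v in log_constraints x y z lam dy s]
    2 (fun i v => let: (x, y, z, lam, dy, s) := v in lam 0 i).

Definition row2 (R : realType) (a b : R) : 'rV[R]_2 :=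
  \row_(j < 2) if j == 0 then a else b.

(* Main.v *)
(** The point is the unique maximiser over the relaxation of a linear
    functional, hence an extreme point, and its second binary coordinate is
    [1/2]. The functional is the sum of the left-hand sides of the inequalities
      x <= 3,  y <= 3,  lam1 <= 1,  lam1 + 2 lam2 <= 2,
      dy1 - 3 lam1 <= 0,  dy2 - 3 lam2 <= 0,
      z - 3 x - (dy1 - 3 lam1) - 2 (dy2 - 3 lam2) <= 0,
    all tight at the point; together with dy = y - s they determine it. *)
Require Import Defs.
From mathcomp Require Import all_boot all_order all_algebra.
From mathcomp Require Import classical_sets reals.
From mathcomp Require Import ring lra.
Import Order.TTheory GRing.Theory Num.Theory.
Local Open Scope ring_scope.

(** If [p] lies strictly between [a] and [b], then [f p] averages two values at most [f p] with
    positive weights, so both equal [f p]. *)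
Lemma extreme_point_unique_max (R : realType) (V : lmodType R) (P : set V)
    (f : V -> R) (p : V) :
  (forall (t : R) u v, f (t *: u + (1 - t) *: v) = t * f u + (1 - t) * f v) ->
  P p -> (forall v, P v -> f v <= f p) ->
  (forall v, P v -> f v = f p -> v = p) ->
  extreme_point P p.
Proof.
move=> faff Pp fmax funiq; split=> // a b t Pa Pb /andP[t0 t1] /(congr1 f).
rewrite faff => E; have la := fmax _ Pa; have lb := fmax _ Pb.
by split; apply: funiq => //; apply/eqP; rewrite eq_le ?la ?lb /=; nra.
Qed.

Lemma row2_eta {R : realType} (v : 'rV[R]_2) : v = row2 (v 0 0) (v 0 1).
Proof.
apply/rowP => j; rewrite mxE; case: eqP => [->//|/eqP j0].
by congr (v 0 _); apply/val_inj; case: j j0 => [[|[|]]].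
Qed.

(** The sum with coefficients collected; the [dy 0 0] terms cancel. *)
Definition tight_functional {R : realType} (v : mccormick_space R) : R :=
  let: (x, y, z, lam, dy, s) := v in
  - 2 * x + y + z + 2 * lam 0 0 + 5 * lam 0 1 - dy 0 1.

Lemma tight_functional_affine (R : realType) (t : R) (u v : mccormick_space R) :
  tight_functional (t *: u + (1 - t) *: v) =
  t * tight_functional u + (1 - t) * tight_functional v.
Proof.
case: u => [[[[[x y] z] lam] dy] s]; case: v => [[[[[x' y'] z'] lam'] dy'] s'].
rewrite /tight_functional /= !mxE /GRing.scale /=; ring.
Qed.

Theorem mainTheorem10 (R : realType) :
  ~ ideal (log_formulation R) /\
  extreme_point (lp_relaxation (log_formulation R))
    (mccormick_point 3 3 9
       (row2 1 (1 / 2)) (row2 3 (3 / 2)) (row2 0 (3 / 2))).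
Proof.
set p := mccormick_point _ _ _ _ _ _.
suff ext : extreme_point (lp_relaxation (log_formulation R)) p.
  split=> // /(_ p ext (1 : 'I_2)).
  by rewrite /= mxE /= => -[] ?; lra.
(* 9 = 3 + 3 + 1 + 2 is the sum of the right-hand sides, hence an upper bound on the relaxation. *)
have fp : tight_functional p = 9 by rewrite /= !mxE /=; lra.
apply: (@extreme_point_unique_max _ _ _ (@tight_functional R)).
- exact: tight_functional_affine.
- split=> /=; first by split; rewrite ?mxE /=; repeat split;
    try (move=> i; rewrite mxE; case: ifP => _); lra.
  by move=> i; rewrite mxE; case: ifP => _; lra.
- move=> v; rewrite fp; case: v => [[[[[x y] z] lam] dy] s] [/= + bin].
  have := bin 0; have := bin 1 => /= /andP[? ?] /andP[? ?].
  by move=> [[? ? ?] [? ? ? ?] [? ?] [? ? ? ?] [_ _ /andP[? ?] /andP[? ?]]]; lra.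
- move=> v; rewrite fp; case: v => [[[[[x y] z] lam] dy] s] [/= + bin].
  have := bin 0; have := bin 1 => /= /andP[? ?] /andP[? ?].
  move=> [[? ? ?] [? ? ? ?] [? ?] [? ? ? ?] [_ _ /andP[? ?] /andP[? ?]]] fv.
  rewrite (row2_eta lam) (row2_eta dy) (row2_eta s) /p /mccormick_point.
  (* By [fv] the summed inequality is an equality, so each of the seven summands is tight; the
     values of [s] then follow from [dy = y - s]. *)
  have -> : x = 3 by lra.
  have -> : y = 3 by lra.
  have -> : z = 9 by lra.
  have -> : lam 0 0 = 1 by lra.
  have -> : lam 0 1 = 1 / 2 by lra.
  have -> : dy 0 0 = 3 by lra.
  have -> : dy 0 1 = 3 / 2 by lra.
  have -> : s 0 0 = 0 by lra.
  by have -> : s 0 1 = 3 / 2 by lra.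
Qed.
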